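(* Let $\Bbbk$ be an algebraically closed field of characteristic zero, let $\mathcal{A}$ be the Kac–Paljutkin Hopf algebra over $\Bbbk$ and let $q\in\Bbbk$ be a primitive fourth root of unity. The partial actions of $\mathcal{A}$ on $\Bbbk$ are exactly the counit $\varepsilon_{\mathcal{A}}$ (the global action), the linear maps $\lambda_\zeta$ for $\zeta\in\{q,-q\}$, and the linear maps $\lambda_N^0$ for each subgroup $N$ of $G(\mathcal{A})=\{1,g,h,gh\}$.
   Context: A partial action of a Hopf algebra $H$ on its base field $\Bbbk$ is a linear map $\lambda:H\to\Bbbk$ with $\lambda(1_H)=1$ and $\lambda(u)\lambda(v)=\lambda(u_1)\lambda(u_2v)$ for all $u,v\in H$ (Sweedler notation $\Delta(u)=u_1\otimes u_2$). The Kac–Paljutkin algebra $\mathcal{A}$ is the $8$-dimensional Hopf algebra generated as an algebra by $g,h,x$ with relations $g^2=h^2=1$, $x^2=\tfrac12(1+g+h-gh)$, $hg=gh$, $xh=gx$, $xg=hx$; it has linear basis $\mathcal{B}_{\mathcal{A}}=\{1,g,h,gh,x,gx,hx,ghx\}$. Its coproduct is determined by $g,h$ being grouplike and $\Delta(x)=\tfrac12(x\otimes x+x\otimes gx+hx\otimes x-hx\otimes gx)$; $\varepsilon(k)=1$ for all $k\in\mathcal{B}_{\mathcal{A}}$; $S(g)=g$, $S(h)=h$, $S(x)=x$. Its group of grouplike elements is $G(\mathcal{A})=\{1,g,h,gh\}\cong C_2\times C_2$. For a subgroup $N$ of $G(\mathcal{A})$, the linear map $\lambda_N^0:\mathcal{A}\to\Bbbk$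 is given by $\lambda_N^0(t)=1$ if $t\in N$ and $\lambda_N^0(t)=0$ if $t\in\mathcal{B}_{\mathcal{A}}\setminus N$. For $\zeta\in\{q,-q\}$, the linear map $\lambda_\zeta:\mathcal{A}\to\Bbbk$ is given by $\lambda_\zeta(1)=\lambda_\zeta(gh)=1$, $\lambda_\zeta(g)=\lambda_\zeta(h)=0$, $\lambda_\zeta(x)=\lambda_\zeta(ghx)=\tfrac{1+\zeta}{2}$, $\lambda_\zeta(gx)=\lambda_\zeta(hx)=\tfrac{1-\zeta}{2}$. *)

(* Defs.v *)
From HB Require Import structures.
From mathcomp Require Import all_boot all_order all_algebra all_field.

Set Implicit Arguments.
Unset Strict Implicit.
Unset Printing Implicit Defensive.

Import GRing.Theory.
Local Open Scope ring_scope.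

(* Tensor products of finite-dimensional spaces: an element of V (x) W is the *)
(* matrix of its coordinates on the products of the basis vectors of V and W. *)
Definition tensor (K : fieldType) (V W : vectType K) : Type :=
  'M[K]_(\dim {:V}, \dim {:W}).

HB.instance Definition _ (K : fieldType) (V W : vectType K) :=
  Vector.copy (tensor V W) 'M[K]_(\dim {:V}, \dim {:W}).

Definition tens (K : fieldType) (V W : vectType K) (v : V) (w : W) :
    tensor V W :=
  \matrix_(i, j) (coord (vbasis {:V}) i v * coord (vbasis {:W}) j w).

(* For bilinear f, [tens_lift f] is the linear map on V (x) W induced by f    *)
(* (see tens_liftE), so that [tens_lift (fun u1 u2 => E) (comul u)] is the    *)
(* value of the expression E in Sweedler notation.                            *)
Definition tens_lift (K : fieldType) (V W : vectType K) (Z : lmodType K)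
    (f : V -> W -> Z) (t : tensor V W) : Z :=
  \sum_i \sum_j t i j *: f (vbasis {:V})`_i (vbasis {:W})`_j.

Definition tens_mul (K : fieldType) (A B : falgType K) (s t : tensor A B) :
    tensor A B :=
  tens_lift (fun a b => tens_lift (fun c d => tens (a * c) (b * d)) t) s.

Lemma tens_bilinear (K : fieldType) (V W : vectType K) :
  (forall w : W, linear (fun v : V => tens v w)) /\
  (forall v : V, linear (fun w : W => tens v w)).
Proof.
split=> [w a v1 v2|v a w1 w2]; apply/matrixP=> i j; rewrite !mxE linearP /=.
  by rewrite mulrDl mulrA.
by rewrite mulrDr mulrCA.
Qed.

Lemma tens_lift_linear (K : fieldType) (V W : vectType K) (Z : lmodType K)
  (f : V -> W -> Z) : linear (tens_lift f).
Proof.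
move=> a s t; rewrite /tens_lift scaler_sumr -big_split; apply: eq_bigr => i _.
rewrite /= scaler_sumr -big_split; apply: eq_bigr => j _.
by rewrite /= !mxE scalerDl scalerA.
Qed.

Lemma tens_liftE (K : fieldType) (V W : vectType K) (Z : lmodType K)
  (f : V -> W -> Z) :
  (forall w, linear (fun v => f v w)) -> (forall v, linear (f v)) ->
  forall v w, tens_lift f (tens v w) = f v w.
Proof.
move=> fl fr v w; rewrite /tens_lift.
have sumr (I : finType) (F : I -> W) u : f u (\sum_i F i) = \sum_i f u (F i).
  have f0 : f u 0 = 0.
    by have := fr u (-1) 0 0; rewrite scaler0 addr0 scaleN1r addNr.
  apply: (big_morph (f u)) => // a b.
  by have := fr u 1 a b; rewrite !scale1r.
have suml (I : finType) (F : I -> V) u : f (\sum_i F i) u = \sum_i f (F i) u.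
  have f0 : f 0 u = 0.
    by have := fl u (-1) 0 0; rewrite /= scaler0 addr0 scaleN1r addNr.
  apply: (big_morph (fun v => f v u)) => // a b.
  by have /= := fl u 1 a b; rewrite !scale1r.
have fZr a u x : f u (a *: x) = a *: f u x.
  have := fr u a x 0; rewrite !addr0 => ->.
  by have := fr u (-1) 0 0; rewrite scaler0 addr0 scaleN1r addNr => ->; rewrite addr0.
have fZl a u x : f (a *: x) u = a *: f x u.
  have /= := fl u a x 0; rewrite !addr0 => ->.
  by have /= := fl u (-1) 0 0; rewrite scaler0 addr0 scaleN1r addNr => ->; rewrite addr0.
rewrite [in RHS](coord_vbasis (memvf v)) suml; apply: eq_bigr => i _.
rewrite [in RHS](coord_vbasis (memvf w)) sumr; apply: eq_bigr => j _.
by rewrite mxE fZl fZr scalerA.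
Qed.

HB.mixin Record isHopfAlgebra (K : fieldType) H of Falgebra K H := {
  comul : H -> tensor H H;
  counit : H -> K;
  antipode : H -> H;
  comul_linear : linear comul;
  counit_linear : linear (counit : H -> K^o);
  antipode_linear : linear antipode;
  comul1 : comul 1 = tens 1 1;
  comulM : forall u v, comul (u * v) = tens_mul (comul u) (comul v);
  counit1 : counit 1 = 1;
  counitM : forall u v, counit (u * v) = counit u * counit v;
  comulA : forall u,
    tens_lift (fun u1 u2 => tens_lift (fun u21 u22 =>
      tens (tens u1 u21) u22) (comul u2)) (comul u)
    = tens_lift (fun u1 u2 => tens (comul u1) u2) (comul u);
  counitl : forall u, tens_lift (fun u1 u2 => counit u1 *: u2) (comul u) = u;
  counitr : forall u, tens_lift (fun u1 u2 => counit u2 *: u1) (comul u) = u;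
  antipodel : forall u,
    tens_lift (fun u1 u2 => antipode u1 * u2) (comul u) = (counit u)%:A;
  antipoder : forall u,
    tens_lift (fun u1 u2 => u1 * antipode u2) (comul u) = (counit u)%:A
}.

#[short(type="hopfAlgType")]
HB.structure Definition HopfAlgebra (K : fieldType) :=
  { H of isHopfAlgebra K H & Falgebra K H }.

Definition grouplike (K : fieldType) (H : hopfAlgType K) : {pred H} :=
  [pred u | (comul u == tens u u) && (counit u == 1)].

Definition grouplike_subgroup (K : fieldType) (H : hopfAlgType K)
    (N : {pred H}) : Prop :=
  {subset N <= @grouplike K H} /\ divr_closed N.

Definition partial_action (K : fieldType) (H : hopfAlgType K)
    (lambda : {linear H -> K^o}) : Prop :=
  lambda 1 = 1 /\
  forall u v : H, lambda u * lambda v =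
    tens_lift (fun u1 u2 => lambda u1 * lambda (u2 * v) : K^o) (comul u).

Definition kp_basis (K : fieldType) (A : falgType K) (g h x : A) :
    8.-tuple A :=
  [tuple 1; g; h; g * h; x; g * x; h * x; g * h * x].

(* The Hopf algebra A, with the elements g, h and x, is the Kac-Paljutkin     *)
(* algebra.                                                                   *)
Record kac_paljutkin (K : fieldType) (A : hopfAlgType K) (g h x : A) : Prop := {
  kp_g2 : g ^+ 2 = 1;
  kp_h2 : h ^+ 2 = 1;
  kp_x2 : x ^+ 2 = 2^-1 *: (1 + g + h - g * h);
  kp_hg : h * g = g * h;
  kp_xh : x * h = g * x;
  kp_xg : x * g = h * x;
  kp_basisP : basis_of {:A} (kp_basis g h x);
  kp_comul_g : comul g = tens g g;
  kp_comul_h : comul h = tens h h;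
  kp_comul_x : comul x = 2^-1 *: (tens x x + tens x (g * x)
                                  + tens (h * x) x - tens (h * x) (g * x));
  kp_counit : {in kp_basis g h x, forall b, counit b = 1};
  kp_antipode_g : antipode g = g;
  kp_antipode_h : antipode h = h;
  kp_antipode_x : antipode x = x
}.

(* The linear map taking the value f_i on the i-th vector of the basis.       *)
Definition kp_map (K : fieldType) (A : falgType K) (g h x : A)
    (f : 8.-tuple K) (u : A) : K :=
  \sum_i coord (kp_basis g h x) i u * tnth f i.

Definition lambda0 (K : fieldType) (A : falgType K) (g h x : A)
    (N : {pred A}) : A -> K :=
  kp_map g h x [tuple of [seq (t \in N)%:R | t <- kp_basis g h x]].

Definition lambda_zeta (K : fieldType) (A : falgType K) (g h x : A)
    (zeta : K) : A -> K :=
  kp_map g h x [tuple 1; 0; 0; 1; (1 + zeta) / 2; (1 - zeta) / 2;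
                      (1 - zeta) / 2; (1 + zeta) / 2].

(* Main.v *)
(* The defining identity of a partial action is bilinear in (u, v), so it    *)
(* only has to be tested on pairs of basis vectors. At u = t grouplike it     *)
(* reads lambda(t) (lambda(v) - lambda(t v)) = 0; hence lambda takes values   *)
(* in {0, 1} on G(A), and the t with lambda(t) = 1 form a subgroup N which    *)
(* leaves lambda invariant. For each N the identities with u in               *)
(* {x, gx, hx, ghx} and v grouplike are quadratic equations in the values of  *)
(* lambda at x, gx, hx, ghx. They force these values to vanish, except that   *)
(* the value 1 is also possible for N = G(A), which gives the counit, and     *)
(* that for N = {1, gh} the values a = lambda(x) and b = lambda(gx) satisfy   *)
(* a^2 + b^2 = 0 and a + b = 2 a b, so a + b is 0 or 1 and in the second case *)
(* (2 a - 1)^2 = -1.                                                          *)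

From HB Require Import structures.
Require Import Defs.
From mathcomp Require Import all_boot all_order all_algebra all_field.
From mathcomp Require Import ring.

Import GRing.Theory.
Local Open Scope ring_scope.

Set Implicit Arguments.
Unset Strict Implicit.
Unset Printing Implicit Defensive.

(** By bilinearity a partial action amounts to [lambda 1 = 1] and finitely many quadratic equations
    in its values on the basis ([partial_action_basis]). Grouplike u make lambda the indicator of a
    subgroup N on {1, g, h, gh}, invariant under left multiplication by N. The four values on the
    coset of x are then found by [kp_solutions], and [kp_partial_actionE] turns each solution into
    one of the three families.

    Conversely, the counit is multiplicative, [lambda_zeta] is checked on pairs of basis vectors
    using zeta^2 = -1, and for [lambda0] the identity is the coset property of N when u is grouplike
    and reads 0 = 0 when u is in the coset of x. Since [lambda0] sees N only through the basis, what
    enters about grouplikes is that 1, g, h, gh are grouplike ([kp_grouplike]) and the other basis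
    vectors are not ([kp_x_coset_not_grouplike]). *)

Lemma scale_regularE (R : nzRingType) (a : R) (b : R^o) : a *: b = a * b.
Proof. by []. Qed.

Lemma idem_field (F : fieldType) (y : F) : y * y = y -> y = 0 \/ y = 1.
Proof.
move/eqP; rewrite -subr_eq0 -{3}[y]mulr1 -mulrBr mulf_eq0 subr_eq0.
by case/orP=> /eqP; [left|right].
Qed.

(** * The quadratic equations and their solutions *)

Section Solutions.
Variables (K : fieldType) (q : K).
Hypotheses (K2 : (2 : K) != 0) (q2 : q ^+ 2 = -1).

(* The unknowns are the values of a partial action at g, h, gh and at         *)
(* x, gx, hx, ghx; the equations are its defining identity at pairs (u, v).   *)
Lemma kp_solutions (e f k a b c d : K) :
  e * e = e -> f * f = f -> k * k = k ->
  e * f = e * k -> f * e = f * k -> k * e = k * f ->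
  (e * a = e * b /\ e * c = e * d) ->
  (f * a = f * c /\ f * b = f * d) ->
  (k * a = k * d /\ k * b = k * c) ->
  [/\ 2 * a = a * a + a * b + c * a - c * b,
      2 * (a * e) = a * c + a * d + c * c - c * d,
      2 * (a * f) = a * b + a * a + c * b - c * a &
      2 * (a * k) = a * d + a * c + c * d - c * c] ->
  [/\ 2 * b = b * b + b * a + d * b - d * a,
      2 * (b * e) = b * d + b * c + d * d - d * c,
      2 * (b * f) = b * a + b * b + d * a - d * b &
      2 * (b * k) = b * c + b * d + d * c - d * d] ->
  [/\ 2 * c = c * c + c * d + a * c - a * d,
      2 * (c * e) = c * a + c * b + a * a - a * b,
      2 * (c * f) = c * d + c * c + a * d - a * c &
      2 * (c * k) = c * b + c * a + a * b - a * a] ->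
  [/\ 2 * d = d * d + d * c + b * d - b * c,
      2 * (d * e) = d * b + d * a + b * b - b * a,
      2 * (d * f) = d * c + d * d + b * c - b * d &
      2 * (d * k) = d * a + d * b + b * a - b * b] ->
  [\/ [/\ e = 1, f = 1 & k = 1] /\ [/\ a = 1, b = 1, c = 1 & d = 1],
      exists2 z, z \in [:: q; - q] &
        [/\ e = 0, f = 0 & k = 1] /\
        [/\ a = (1 + z) / 2, b = (1 - z) / 2, c = (1 - z) / 2 & d = (1 + z) / 2]
    | [/\ a = 0, b = 0, c = 0 & d = 0]].
Proof.
have idem := @idem_field K.
have sq0 (y : K) : y * y = 0 -> y = 0.
  by move/eqP; rewrite mulf_eq0 orbb => /eqP.
have dbl0 (y : K) : 2 * y = 0 -> y = 0.
  by move/eqP; rewrite mulf_eq0 (negPf K2) => /eqP.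
have vanish (a' b' c' d' : K) :
    2 * a' = a' * a' + a' * b' + c' * a' - c' * b' ->
    0 = a' * c' + a' * d' + c' * c' - c' * d' ->
    0 = a' * b' + a' * a' + c' * b' - c' * a' ->
    0 = a' * d' + a' * c' + c' * d' - c' * c' ->
    0 = b' * d' + b' * c' + d' * d' - d' * c' ->
    0 = b' * c' + b' * d' + d' * c' - d' * d' -> a' = 0.
  move=> E1 Eg Eh Egh Fg Fgh.
  (* The combination Eg - Egh + Fg - Fgh of the right-hand sides is 2 (c' - d')^2. *)
  have /eqP : c' - d' = 0.
    apply: sq0; apply: dbl0.
    transitivity ((a' * c' + a' * d' + c' * c' - c' * d')
      - (a' * d' + a' * c' + c' * d' - c' * c')
      + ((b' * d' + b' * c' + d' * d' - d' * c')
      - (b' * c' + b' * d' + d' * c' - d' * d'))); first by ring.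
    by rewrite -Eg -Egh -Fg -Fgh !subr0 addr0.
  rewrite subr_eq0 => /eqP cd; subst d'.
  have ac0 : a' * c' = 0 by apply: dbl0; rewrite [RHS]Eg; ring.
  (* Half of E1 - Eh; multiplied by a', it gives a'^2 = 0 because a' c' = 0. *)
  have aE : a' = c' * a' - c' * b'.
    by apply: (mulfI K2); rewrite E1 -[LHS]subr0 Eh; ring.
  apply: sq0; rewrite {2}aE.
  transitivity (a' * c' * (a' - b')); first by ring.
  by rewrite ac0 mul0r.
move=> /idem[]-> /idem[]-> /idem[]->; rewrite ?(mul0r, mul1r, mulr0, mulr1).
all: move=> ef fe ke [ea ec] [fa fb] [ka kb].
all: move=> [a1 ag ah agh] [b1 bg bh bgh] [c1 cg ch cgh] [d1 dg dh dgh].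
(* The value 1 cannot be taken at exactly two of g, h, gh: these cases do not come from a
   subgroup. *)
all: try by [move/eqP: ef; rewrite ?[0 == 1]eq_sym oner_eq0
            | move/eqP: fe; rewrite ?[0 == 1]eq_sym oner_eq0].
(* N is trivial. The relabelings come from left multiplication by g, h and gh, which preserves the
   system. *)
- apply: Or33; split.
  + exact: (vanish a b c d).
  + exact: (vanish b a d c).
  + exact: (vanish c d a b).
  + exact: (vanish d c b a).
- subst d c.
  have s0 : a * a + b * b = 0 by rewrite ag; ring.
  have sE : a + b = 2 * (a * b).
    by apply: (mulfI K2); rewrite mulrDr a1 b1; ring.
  (* Here N = {1, gh}, and (a + b)^2 = (a^2 + b^2) + 2ab is a + b by [s0] and [sE]. *)
  have /idem[ab|ab] : (a + b) * (a + b) = a + b.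
    by rewrite [RHS]sE -[RHS]add0r -s0; ring.
  + have bE : b = - a by apply/eqP; rewrite -addr_eq0 addrC ab.
    have a0 : a = 0 by apply: sq0; apply: dbl0; rewrite -s0 bE; ring.
    by apply: Or33; rewrite bE a0 oppr0.
  have bE : b = 1 - a by rewrite -ab addrC addKr.
  apply: Or32; exists (2 * a - 1).
    rewrite !inE -eqf_sqr q2 -subr_eq0 -(mulr0 2) -s0 bE; apply/eqP; ring.
  by rewrite bE; do !split => //; field; exact: K2.
(* For N = {1, h}, and likewise for N = {1, g} below, invariance turns the equations at the element
   of G(A) used into twice a square being 0. *)
- subst c d.
  have a0 : a = 0 by apply: sq0; apply: dbl0; rewrite ag; ring.
  have b0 : b = 0 by apply: sq0; apply: dbl0; rewrite bg; ring.
  by apply: Or33.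
- subst b d.
  have a0 : a = 0 by apply: sq0; apply: dbl0; rewrite ah; ring.
  have c0 : c = 0 by apply: sq0; apply: dbl0; rewrite ch; ring.
  by apply: Or33.
subst d c b.
have /idem[a0|a0] : a * a = a by apply: (mulfI K2); rewrite a1; ring.
  by apply: Or33.
by apply: Or31.
Qed.
End Solutions.

(** * Linear maps on tensor products *)

Section Tensor.
Variable K : fieldType.

Lemma tens_lift_tens (V W : vectType K) (f : {linear V -> K^o})
    (f' : {linear W -> K^o}) (v : V) (w : W) :
  tens_lift (fun a b => f a * f' b : K^o) (tens v w) = f v * f' w.
Proof.
apply: (tens_liftE (f := fun a b => f a * f' b : K^o)) => [b a u u'|a c u u'].
  by rewrite linearP /= !scale_regularE mulrDl mulrA.
by rewrite linearP /= !scale_regularE mulrDr mulrCA.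
Qed.

Lemma tens_lift_mulr (A : falgType K) (f : {linear A -> K^o}) (v a b : A) :
  tens_lift (fun u1 u2 => f u1 * f (u2 * v) : K^o) (tens a b) = f a * f (b * v).
Proof.
apply: (tens_liftE (f := fun a b => f a * f (b * v) : K^o)) => [w c u u'|w c u u'].
  by rewrite linearP /= !scale_regularE mulrDl mulrA.
by rewrite mulrDl -scalerAl linearP /= !scale_regularE mulrDr mulrCA.
Qed.

Lemma tens_mulE (A B : falgType K) (a c : A) (b d : B) :
  tens_mul (tens a b) (tens c d) = tens (a * c) (b * d).
Proof.
have [tl tr] := tens_bilinear A B.
have inner a' b' : tens_lift (fun c d => tens (a' * c) (b' * d)) (tens c d)
    = tens (a' * c) (b' * d).
  apply: (tens_liftE (f := fun c d => tens (a' * c) (b' * d)))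
    => [w k u u'|w k u u'].
    by rewrite mulrDr -scalerAr tl.
  by rewrite mulrDr -scalerAr tr.
rewrite /tens_mul (tens_liftE (f := fun a b => _)) ?inner // => [w k u u'|w k u u'].
  by rewrite !inner mulrDl -scalerAl tl.
by rewrite !inner mulrDl -scalerAl tr.
Qed.

HB.instance Definition _ (V W : vectType K) (Z : lmodType K) (f : V -> W -> Z) :=
  GRing.isLinear.Build K (tensor V W) Z *:%R (tens_lift f) (tens_lift_linear f).

Lemma tens_lift_linearr (V W : vectType K) (Y Z : lmodType K)
    (f : Y -> V -> W -> Z) (t : tensor V W) :
  (forall a b, linear (fun y => f y a b)) -> linear (fun y => tens_lift (f y) t).
Proof.
move=> lf k y y'; rewrite /tens_lift scaler_sumr -big_split.
apply: eq_bigr => i _ /=; rewrite scaler_sumr -big_split; apply: eq_bigr => j _ /=.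
by rewrite lf scalerDr !scalerA mulrC.
Qed.

Lemma tens_mul_linearr (A B : falgType K) (s : tensor A B) :
  linear (tens_mul s).
Proof.
by apply: tens_lift_linearr => a b; apply: tens_lift_linear.
Qed.

HB.instance Definition _ (A B : falgType K) (s : tensor A B) :=
  GRing.isLinear.Build K (tensor A B) (tensor A B) *:%R (tens_mul s)
    (tens_mul_linearr s).

End Tensor.

(** * Testing the partial action identity on a basis *)

Section Hopf.
Variables (K : fieldType) (H : hopfAlgType K).

HB.instance Definition _ :=
  GRing.isLinear.Build K H (tensor H H) *:%R comul (@comul_linear K H).

HB.instance Definition _ :=
  GRing.isLinear.Build K H K^o *:%R (counit : H -> K^o) (@counit_linear K H).

Lemma grouplikeM (u v : H) :
  u \in @grouplike K H -> v \in @grouplike K H -> u * v \in @grouplike K H.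
Proof.
move=> /andP[/eqP cu /eqP eu] /andP[/eqP cv /eqP ev].
by rewrite inE comulM cu cv tens_mulE counitM eu ev mulr1 !eqxx.
Qed.

(** Linearity is a hypothesis because the maps compared include slices of bilinear maps, which carry
    no linear structure of their own. *)
Lemma eq_linear_basis n (X : n.-tuple H) (f f' : H -> K^o) :
  basis_of {:H} X -> linear f -> linear f' -> {in X, f =1 f'} -> f =1 f'.
Proof.
move=> bX lf lf' ff u.
pose L : {linear H -> K^o} :=
  HB.pack f (GRing.isLinear.Build K H K^o *:%R f lf).
pose L' : {linear H -> K^o} :=
  HB.pack f' (GRing.isLinear.Build K H K^o *:%R f' lf').
rewrite -[f u]/(L u) -[f' u]/(L' u) (coord_basis bX (memvf u)) !linear_sum.
apply: eq_bigr => i _; rewrite !linearZ; congr (_ *: _).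
by apply: ff; rewrite mem_nth ?size_tuple.
Qed.

Definition sweedler_prod (f : {linear H -> K^o}) (u v : H) : K^o :=
  tens_lift (fun u1 u2 => f u1 * f (u2 * v) : K^o) (comul u).

Lemma sweedler_prod_linearl (f : {linear H -> K^o}) v :
  linear ((sweedler_prod f)^~ v).
Proof. by move=> k u u'; rewrite /sweedler_prod !linearP. Qed.

Lemma sweedler_prod_linearr (f : {linear H -> K^o}) u :
  linear (sweedler_prod f u).
Proof.
apply: tens_lift_linearr => a b k v v'.
by rewrite mulrDr -scalerAr linearP /= !scale_regularE mulrDr mulrCA.
Qed.

Lemma partial_action_basis n (X : n.-tuple H) (f : {linear H -> K^o}) :
  basis_of {:H} X -> f 1 = 1 ->
  {in X &, forall u v, f u * f v = sweedler_prod f u v} -> partial_action f.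
Proof.
move=> bX f1 eX; split=> // u0 v0.
apply: (@eq_linear_basis _ X (fun u => f u * f v0) (sweedler_prod f ^~ v0) bX _ _ _ u0)
  => [k a b||u uX].
- by rewrite linearP /= !scale_regularE mulrDl mulrA.
- exact: sweedler_prod_linearl.
apply: (@eq_linear_basis _ X (fun v => f u * f v) (sweedler_prod f u) bX _ _ _ v0)
  => [k a b||v vX].
- by rewrite linearP /= !scale_regularE mulrDr mulrCA.
- exact: sweedler_prod_linearr.
exact: eX.
Qed.

End Hopf.

(** * Products and coproducts in the Kac-Paljutkin algebra *)

Section KacPaljutkin.
Variables (K : fieldType) (A : hopfAlgType K) (g h x : A).
Hypotheses (hA : kac_paljutkin g h x) (K2 : (2 : K) != 0).
Implicit Types f : {linear A -> K^o}.

Let bX := kp_basisP hA.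

(** Rewrite rules towards the normal form g^i h^j x^k; the versions with a prefix u apply inside
    left-associated words. *)
Lemma kp_mul :
  ((g * g = 1)%R * (h * h = 1)%R * (h * g = g * h)%R * (x * h = g * x)%R *
   (x * g = h * x)%R * (x * x = 2^-1 *: (1 + g + h - g * h))%R *
   (forall u, u * g * g = u)%R * (forall u, u * h * h = u)%R *
   (forall u, u * h * g = u * g * h)%R * (forall u, u * x * h = u * g * x)%R *
   (forall u, u * x * g = u * h * x)%R *
   (forall u, u * x * x = 2^-1 *: (u + u * g + u * h - u * g * h))%R)%type.
Proof.
do ![apply: pair]; try move=> u; rewrite -?mulrA;
  rewrite -?expr2 ?(kp_g2 hA) ?(kp_h2 hA) ?(kp_x2 hA) ?(kp_hg hA) ?(kp_xh hA)
    ?(kp_xg hA) ?mulr1 //.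
by rewrite -scalerAr !mulrDr mulr1 mulrN.
Qed.

Lemma kp_comul :
  ((comul g = tens g g)%R * (comul h = tens h h)%R *
   (comul (g * h) = tens (g * h) (g * h))%R *
   (comul x = 2^-1 *: (tens x x + tens x (g * x)
                       + tens (h * x) x - tens (h * x) (g * x)))%R *
   (comul (g * x) = 2^-1 *: (tens (g * x) (g * x) + tens (g * x) x
                       + tens (g * h * x) (g * x) - tens (g * h * x) x))%R *
   (comul (h * x) = 2^-1 *: (tens (h * x) (h * x) + tens (h * x) (g * h * x)
                       + tens x (h * x) - tens x (g * h * x)))%R *
   (comul (g * h * x) = 2^-1 *: (tens (g * h * x) (g * h * x)
          + tens (g * h * x) (h * x)
          + tens (g * x) (g * h * x) - tens (g * x) (h * x)))%R)%type.
Proof.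
have cg := kp_comul_g hA; have ch := kp_comul_h hA; have cx := kp_comul_x hA.
have cgh : comul (g * h) = tens (g * h) (g * h) by rewrite comulM cg ch tens_mulE.
do ![apply: pair] => //.
all: rewrite comulM ?cgh ?cg ?ch cx linearZ linearB !linearD /= !tens_mulE.
all: by rewrite !mulrA !kp_mul ?mul1r !scalerDr.
Qed.

Lemma forall_kp_basis (P : A -> Prop) :
  {in kp_basis g h x, forall v, P v} <->
  [/\ P 1, P g, P h & P (g * h)] /\
  [/\ P x, P (g * x), P (h * x) & P (g * h * x)].
Proof.
split=> [Pb|[[? ? ? ?] [? ? ? ?]] v]; last first.
  by rewrite !inE; do !case/predU1P => [-> //|]; move/eqP->.
by do !split; apply: Pb; rewrite !inE eqxx ?orbT.
Qed.

Lemma sweedler_prod_kp f v :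
  ((sweedler_prod f 1 v = f 1 * f v)%R *
   (sweedler_prod f g v = f g * f (g * v))%R *
   (sweedler_prod f h v = f h * f (h * v))%R *
   (sweedler_prod f (g * h) v = f (g * h) * f (g * h * v))%R *
   (sweedler_prod f x v = 2^-1 * (f x * f (x * v) + f x * f (g * x * v)
      + f (h * x) * f (x * v) - f (h * x) * f (g * x * v)))%R *
   (sweedler_prod f (g * x) v = 2^-1 * (f (g * x) * f (g * x * v)
      + f (g * x) * f (x * v)
      + f (g * h * x) * f (g * x * v) - f (g * h * x) * f (x * v)))%R *
   (sweedler_prod f (h * x) v = 2^-1 * (f (h * x) * f (h * x * v)
      + f (h * x) * f (g * h * x * v)
      + f x * f (h * x * v) - f x * f (g * h * x * v)))%R *
   (sweedler_prod f (g * h * x) v = 2^-1 * (f (g * h * x) * f (g * h * x * v)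
      + f (g * h * x) * f (h * x * v)
      + f (g * x) * f (g * h * x * v) - f (g * x) * f (h * x * v)))%R)%type.
Proof.
rewrite /sweedler_prod comul1 !kp_comul !linearZ !linearB !linearD /=.
by rewrite !tens_lift_mulr !mul1r !scale_regularE !mulrN; do ![apply: pair].
Qed.


Lemma kp_map_linear F : linear (kp_map g h x F : A -> K^o).
Proof.
move=> k u v; rewrite /kp_map scaler_sumr -big_split; apply: eq_bigr => i _ /=.
by rewrite linearP /= !scale_regularE mulrDl mulrA.
Qed.

Lemma kp_map_nth (F : 8.-tuple K) (i : 'I_8) :
  kp_map g h x F (kp_basis g h x)`_i = F`_i.
Proof.
rewrite /kp_map (bigD1 i) //= big1 => [|j ne_ji].
  by rewrite coord_free ?(basis_free bX) // eqxx mul1r addr0 (tnth_nth 0).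
by rewrite coord_free ?(basis_free bX) // eq_sym (negPf ne_ji) mul0r.
Qed.

(** Reduces an identity of maps to an equality of lists, from which the eight values are read off by
    injectivity. *)
Lemma eq_kp_map (f : A -> K^o) (F : 8.-tuple K) : linear f ->
  f =1 kp_map g h x F <-> map f (kp_basis g h x) = F :> seq K.
Proof.
move=> lf; split=> [fF|fF].
  apply: (@eq_from_nth _ 0) => [|i]; rewrite size_map !size_tuple // => lti.
  by rewrite (nth_map 0) ?size_tuple // fF (kp_map_nth F (Ordinal lti)).
apply: (eq_linear_basis bX lf (kp_map_linear F)) => u /(nthP 0) [i].
rewrite size_tuple => lti <-.
by rewrite (kp_map_nth F (Ordinal lti)) -fF (nth_map 0) ?size_tuple.
Qed.

(** * Grouplike basis vectors *)

Lemma kp_grouplike :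
  {subset [:: 1; g; h; g * h] <= @grouplike K A}.
Proof.
have gl u : u \in kp_basis g h x -> comul u = tens u u -> u \in @grouplike K A.
  by move=> uX cu; rewrite inE cu (kp_counit hA uX) !eqxx.
move=> u; rewrite !inE => uX; apply: gl.
  by rewrite !inE; case/or4P: uX => ->; rewrite ?orbT.
by case/or4P: uX => /eqP ->; rewrite ?comul1 ?kp_comul.
Qed.

(** The product of the coordinates along x and gx takes the value 1/2 on the coproduct of x, but 0
    on [tens x x]. *)
Lemma kp_x_not_grouplike : x \notin @grouplike K A.
Proof.
apply/negP => /andP[/eqP + _]; rewrite kp_comul.
pose c (i : 'I_8) : {linear A -> K^o} := coord (kp_basis g h x) i.
have cE (i : 'I_8) (j : 'I_8) : c i (kp_basis g h x)`_j = (i == j)%:R.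
  by rewrite [LHS]coord_free ?(basis_free bX) // eq_sym.
pose i4 := @Ordinal 8 4 isT; pose i5 := @Ordinal 8 5 isT.
pose i6 := @Ordinal 8 6 isT.
have [c4 c46] : c i4 x = 1 /\ c i4 (h * x) = 0.
  by split; [apply: (cE i4 i4) | apply: (cE i4 i6)].
have [c54 c5] : c i5 x = 0 /\ c i5 (g * x) = 1.
  by split; [apply: (cE i5 i4) | apply: (cE i5 i5)].
move=> /(congr1 (tens_lift (fun u v => c i4 u * c i5 v : K^o))).
rewrite linearZ linearB !linearD /= !tens_lift_tens c4 c46 c54 c5.
rewrite !mulr0 !mul0r mul1r add0r subr0 addr0 scale_regularE mulr1.
by apply/eqP; rewrite invr_eq0.
Qed.

(** Since t^2 = 1, multiplying t x by the grouplike t would make x grouplike. *)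
Lemma kp_x_coset_not_grouplike :
  {in [:: 1; g; h; g * h], forall t, t * x \notin @grouplike K A}.
Proof.
move=> t tG; apply: contra kp_x_not_grouplike => /(grouplikeM (kp_grouplike tG)).
by move: tG; rewrite !inE => /or4P[] /eqP->; rewrite !(mulrA, kp_mul, mul1r).
Qed.

(** * The listed maps are partial actions *)

Lemma partial_action_counit f : f =1 counit -> partial_action f.
Proof.
move=> fE; apply: (partial_action_basis bX) => [|u v uX vX].
  by rewrite fE counit1.
have fM a b : f (a * b) = f a * f b by rewrite !fE counitM.
have fX w : w \in kp_basis g h x -> f w = 1.
  by move=> wX; rewrite fE (kp_counit hA wX).
have /forall_kp_basis[[f1 fg fh fgh] [fx fgx fhx fghx]] := fX.
(* For u in the coset of x the factor is (1 + 1 + 1 - 1) / 2 = 1. *)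
suff -> : sweedler_prod f u v = f v by rewrite (fX u) ?mul1r.
move: u uX; apply/forall_kp_basis; rewrite !sweedler_prod_kp !(fM _ v).
rewrite f1 fg fh fgh fx fgx fhx fghx; do !split; rewrite ?mul1r //; field; exact: K2.
Qed.

Lemma kp_half_linear f (u v w t : A) :
  f (2^-1 *: (u + v + w - t)) = 2^-1 * (f u + f v + f w - f t).
Proof. by rewrite linearZ linearD linearN !linearD. Qed.

Lemma partial_action_lambda_zeta f zeta : zeta ^+ 2 = -1 ->
  f =1 lambda_zeta g h x zeta -> partial_action f.
Proof.
move=> z2 /(eq_kp_map _ (linearP f))[f1 fg fh fgh fx fgx fhx fghx].
apply: (partial_action_basis bX) => // u v uX; move: v.
apply/forall_kp_basis; move: u uX; apply/forall_kp_basis.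
do !split.
all: rewrite sweedler_prod_kp ?(mulr1, mul1r, mulrA, kp_mul, kp_half_linear).
all: rewrite ?(f1, fg, fh, fgh, fx, fgx, fhx, fghx) //.
all: by field: z2.
Qed.

Lemma kp_grouplike_sq t : t \in [:: 1; g; h; g * h] -> t * t = 1.
Proof.
by rewrite !inE => /or4P[] /eqP->; rewrite !(mulrA, kp_mul, mul1r).
Qed.

Lemma kp_grouplikeM t u : t \in [:: 1; g; h; g * h] ->
  u \in [:: 1; g; h; g * h] -> t * u \in [:: 1; g; h; g * h].
Proof.
rewrite !inE => /or4P[] /eqP-> /or4P[] /eqP->;
  by rewrite ?(mulrA, kp_mul, mul1r, mulr1) eqxx ?orbT.
Qed.

Lemma kp_grouplikeM_basis t v :
  t \in [:: 1; g; h; g * h] -> v \in kp_basis g h x -> t * v \in kp_basis g h x.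
Proof.
move=> tG; move: v; apply/forall_kp_basis; rewrite !inE in tG *.
case/or4P: tG => /eqP->;
  by do !split; rewrite ?(mulrA, kp_mul, mul1r, mulr1) eqxx ?orbT.
Qed.

Lemma partial_action_lambda0 f (N : {pred A}) :
  grouplike_subgroup N -> f =1 lambda0 g h x N -> partial_action f.
Proof.
move=> [glN divN] /(eq_kp_map _ (linearP f)) fE.
have [N1 mulN] := GRing.divr_closedM divN.
have {}fE : {in kp_basis g h x, forall t, f t = (t \in N)%:R} by apply/eq_in_map.
(* For t in N, v lies in N exactly when t v does, because t (t v) = v; for t outside N both sides
   are 0. *)
have shift t v : t \in [:: 1; g; h; g * h] -> v \in kp_basis g h x ->
    f t * f v = f t * f (t * v).
  move=> tG vX; have tX : t \in kp_basis g h x.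
    by rewrite -[t]mulr1 kp_grouplikeM_basis ?mem_head.
  rewrite !fE ?kp_grouplikeM_basis //.
  case tN: (t \in N); last by rewrite !mul0r.
  congr (_ * _%:R); apply: congr1; apply/idP/idP; first exact: mulN.
  by move/(mulN _ _ tN); rewrite mulrA kp_grouplike_sq ?mul1r.
have f0 t : t \in [:: 1; g; h; g * h] -> f (t * x) = 0.
  have xX : x \in kp_basis g h x by rewrite !inE eqxx ?orbT.
  move=> tG; rewrite fE ?kp_grouplikeM_basis //.
  by rewrite (contraNF (glN _)) // kp_x_coset_not_grouplike.
have [fx fgx fhx fghx] :
    [/\ f x = 0, f (g * x) = 0, f (h * x) = 0 & f (g * h * x) = 0].
  by split; [rewrite -[x]mul1r | | | ]; apply: f0; rewrite !inE eqxx ?orbT.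
apply: (partial_action_basis (kp_basisP hA)) => [|u v uX vX].
  by rewrite fE ?mem_head ?N1.
move: u uX; apply/forall_kp_basis; rewrite !sweedler_prod_kp.
(* For u in the coset of x, each summand has a left factor that is a value of f on that coset. *)
rewrite fx fgx fhx fghx !mul0r !addr0 !subr0 !mulr0.
split; last by split.
by split=> //; apply: shift => //; rewrite !inE eqxx ?orbT.
Qed.

(** * Every partial action is one of the listed maps *)

Lemma kp_partial_actionE f (q : K) : q ^+ 2 = -1 -> partial_action f ->
  [\/ f =1 counit,
      exists2 zeta : K, zeta \in [:: q; - q] & f =1 lambda_zeta g h x zeta
    | exists2 N : {pred A}, grouplike_subgroup N & f =1 lambda0 g h x N].
Proof.
move=> q2 [f1 fP].
have E u v : f u * f v = sweedler_prod f u v by apply: fP.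
have gE t v : t \in [:: 1; g; h; g * h] -> f t * f v = f t * f (t * v).
  rewrite E !inE; case/or4P=> /eqP->; by rewrite !sweedler_prod_kp ?mul1r.
have tE t v w : t \in [:: 1; g; h; g * h] -> t * v = w -> f t * f v = f t * f w.
  by move=> tG <-; apply: gE.
have D u v r : f u * f v = 2^-1 * r -> 2 * (f u * f v) = r.
  by move->; rewrite mulrA divff ?mul1r.
have D1 u r : f u * f 1 = 2^-1 * r -> 2 * f u = r.
  by move/D; rewrite f1 mulr1.
have gG : g \in [:: 1; g; h; g * h] by rewrite !inE eqxx ?orbT.
have hG : h \in [:: 1; g; h; g * h] by rewrite !inE eqxx ?orbT.
have ghG : g * h \in [:: 1; g; h; g * h] by rewrite !inE eqxx ?orbT.
have := @kp_solutions K q K2 q2 (f g) (f h) (f (g * h))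
  (f x) (f (g * x)) (f (h * x)) (f (g * h * x)).
have idem t : t \in [:: 1; g; h; g * h] -> f t * f t = f t.
  by move=> tG; rewrite gE // kp_grouplike_sq // f1 mulr1.
case.
- exact: idem.
- exact: idem.
- exact: idem.
- by apply: tE.
- by apply: tE => //; rewrite kp_mul.
- by rewrite (tE (g * h) g h) // !(mulrA, kp_mul, mul1r).
- by split; apply: tE => //; rewrite !(mulrA, kp_mul, mul1r).
- by split; apply: tE => //; rewrite !(mulrA, kp_mul, mul1r).
- by split; apply: tE => //; rewrite !(mulrA, kp_mul, mul1r).
(* The systems at u = x, gx, hx, ghx, each with v = 1, g, h, gh; [D] and [D1] clear the factor
   1/2. *)
1-4: split; [apply: D1 | apply: D | apply: D | apply: D];
  rewrite E sweedler_prod_kp ?(mulrA, kp_mul, mul1r, mulr1) //.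
- move=> [[eg eh egh] [ex egx ehx eghx]]; apply: Or31.
  apply: (eq_linear_basis (kp_basisP hA) (linearP f) (@counit_linear K A)) => u uX.
  by rewrite (kp_counit hA uX); move: u uX; apply/forall_kp_basis.
- case=> z zq [[eg eh egh] [ex egx ehx eghx]]; apply: Or32; exists z => //.
  by apply/(eq_kp_map _ (linearP f)); rewrite /= f1 eg eh egh ex egx ehx eghx.
move=> [ex egx ehx eghx]; apply: Or33.
pose N : {pred A} := [pred t | (t \in [:: 1; g; h; g * h]) && (f t == 1)].
have glN : {subset N <= @grouplike K A}.
  by move=> t /andP[tG _]; exact: kp_grouplike.
exists N; first split=> //; first split=> [|u v /andP[uG /eqP fu] /andP[vG /eqP fv]].
- by rewrite inE f1 eqxx mem_head.
- have vv := kp_grouplike_sq vG.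
  have vU : v \is a GRing.unit by apply/unitrP; exists v.
  (* Each of 1, g, h, gh is its own inverse, so closure under division reduces to closure under
     products. *)
  have -> : v^-1 = v by apply: (mulrI vU); rewrite divrr.
  apply/andP; split; first exact: kp_grouplikeM.
  by have := gE u v uG; rewrite fu fv !mul1r => /esym/eqP.
apply/(eq_kp_map _ (linearP f)); apply/eq_in_map.
have fG t : t \in [:: 1; g; h; g * h] -> f t = (t \in N)%:R.
  move=> tG; rewrite inE tG /=.
  by case: (idem_field (idem t tG)) => ->; rewrite ?eqxx // eq_sym oner_eq0.
have xN t : t \in [:: 1; g; h; g * h] -> f (t * x) = 0 ->
    f (t * x) = (t * x \in N)%:R.
  by move=> tG ->; rewrite (contraNF (glN _)) // kp_x_coset_not_grouplike.
apply/forall_kp_basis; split; split; try by apply: fG; rewrite ?mem_head.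
- by have := xN 1; rewrite mul1r; apply; rewrite ?mem_head.
- exact: xN.
- exact: xN.
- exact: xN.
Qed.
End KacPaljutkin.

Theorem theorem3p1 (K : closedFieldType) (charK0 : [pchar K] =i pred0)
  (q : K) (hq : 4.-primitive_root q)
  (A : hopfAlgType K) (g h x : A) (hA : kac_paljutkin g h x)
  (lambda : {linear A -> K^o}) :
  partial_action lambda <->
  [\/ lambda =1 counit,
      exists2 zeta : K, zeta \in [:: q; - q]
                      & lambda =1 lambda_zeta g h x zeta
    | exists2 N : {pred A}, grouplike_subgroup N
                          & lambda =1 lambda0 g h x N].
Proof.
have K2 : (2 : K) != 0 by rewrite ((pcharf0P K).1 charK0).
have q2 : q ^+ 2 = -1.
  have /eqP : (q ^+ 2) ^+ 2 = 1 ^+ 2 by rewrite -exprM expr1n prim_expr_order.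
  (* If q^2 were 1, the order 4 of q would divide 2. *)
  rewrite eqf_sqr => /orP[|/eqP //]; rewrite -(prim_order_dvd hq) //.
split=> [|[]]; first exact: (kp_partial_actionE hA K2 q2).
- exact: (partial_action_counit hA K2).
- case=> zeta zq; apply: (partial_action_lambda_zeta hA K2).
  by move: zq; rewrite !inE => /orP[] /eqP->; rewrite ?sqrrN.
- by case=> N; apply: (partial_action_lambda0 hA K2).
Qed.
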